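(* Given an $n$-vertex undirected graph $G=(V,E)$, one can count the number of perfect matchings in $G$ in $\mathcal{O}^\star(2^{n/2})$ time and polynomial space.
   Context: Graphs are finite. The notation $\mathcal{O}^\star(\cdot)$ suppresses factors polynomial in the input size. *)

(* Defs.v *)
From HB Require Import structures.
From mathcomp Require Import all_boot all_order all_algebra.

Set Implicit Arguments.
Unset Strict Implicit.
Unset Printing Implicit Defensive.

Record graph (V : finType) := Graph {
  edges : {set {set V}};
  edges_card2 : forall e, e \in edges -> #|e| = 2
}.

Definition perfect_matching (V : finType) (G : graph V) (M : {set {set V}}) :=
  [&& M \subset edges G, trivIset M & cover M == [set: V]].

Definition num_perfect_matchings (V : finType) (G : graph V) : nat :=
  #|[set M : {set {set V}} | perfect_matching G M]|.

(* The machine model is a random access machine with structured control and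
   logarithmic cost (Cook and Reckhow; Aho, Hopcroft and Ullman): a program
   names finitely many registers and addresses an unbounded memory indirectly,
   registers and memory cells hold arbitrary natural numbers, and every number
   is charged by its length in binary. *)

Inductive binop := Add | Sub | Mul | Div | Mod.

Definition binop_eval (o : binop) : nat -> nat -> nat :=
  match o with
  | Add => addn | Sub => subn | Mul => muln | Div => divn | Mod => modn
  end.

Inductive expr :=
  | Cst of nat
  | Reg of nat
  | Mem of expr
  | Bin of binop & expr & expr.

Inductive cmd :=
  | Skip
  | SetReg of nat & expr
  | SetMem of expr & expr
  | Seq of cmd & cmd
  | If of expr & cmd & cmd
  | While of expr & cmd.

Record state := State { regs : seq nat; mem : seq nat }.

Definition set_reg (s : state) (x v : nat) :=
  State (set_nth 0 (regs s) x v) (mem s).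

Definition set_mem (s : state) (a v : nat) :=
  State (regs s) (set_nth 0 (mem s) a v).

(* The number of binary digits of k, with no digit for 0. *)
Definition bits (k : nat) := up_log 2 k.+1.

(* Each cell costs one unit more than its digits, so that cells holding 0 are
   not free.  All cells up to the largest address written so far are counted,
   so that no information can be hidden in the addresses. *)
Definition cells_size (l : seq nat) := \sum_(k <- l) (bits k).+1.

Definition state_size (s : state) := cells_size (regs s) + cells_size (mem s).

Fixpoint eval (s : state) (e : expr) : nat :=
  match e with
  | Cst k => k
  | Reg x => nth 0 (regs s) x
  | Mem a => nth 0 (mem s) (eval s a)
  | Bin o e1 e2 => binop_eval o (eval s e1) (eval s e2)
  end.

(* The total length of the values of all subexpressions: operands, addresses,
   fetched contents and results are all charged. *)
Fixpoint eval_cost (s : state) (e : expr) : nat :=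
  (bits (eval s e)).+1 +
  match e with
  | Cst _ | Reg _ => 0
  | Mem a => eval_cost s a
  | Bin _ e1 e2 => eval_cost s e1 + eval_cost s e2
  end.

(* exec c s s' t m: started in s, the command c halts in s' after time t, with
   peak space m.  Tests succeed on nonzero values.  The intermediate values of
   an expression count as space while it is being evaluated. *)
Inductive exec : cmd -> state -> state -> nat -> nat -> Prop :=
  | ExecSkip s :
      exec Skip s s 1 (state_size s)
  | ExecSetReg s s' x e of s' = set_reg s x (eval s e) :
      exec (SetReg x e) s s' (eval_cost s e).+1
        (maxn (state_size s + eval_cost s e) (state_size s'))
  | ExecSetMem s s' a e of s' = set_mem s (eval s a) (eval s e) :
      exec (SetMem a e) s s' (eval_cost s a + eval_cost s e).+1
        (maxn (state_size s + (eval_cost s a + eval_cost s e)) (state_size s'))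
  | ExecSeq c1 c2 s1 s2 s3 t1 t2 m1 m2 of
      exec c1 s1 s2 t1 m1 & exec c2 s2 s3 t2 m2 :
      exec (Seq c1 c2) s1 s3 (t1 + t2) (maxn m1 m2)
  | ExecIf e c1 c2 s s' t m of
      exec (if eval s e != 0 then c1 else c2) s s' t m :
      exec (If e c1 c2) s s' ((eval_cost s e).+1 + t)
        (maxn (state_size s + eval_cost s e) m)
  | ExecWhile e c s s' t m of
      exec (If e (Seq c (While e c)) Skip) s s' t m :
      exec (While e c) s s' t m.

Lemma exec_deterministic c s s1 s2 t1 t2 m1 m2 :
  exec c s s1 t1 m1 -> exec c s s2 t2 m2 -> [/\ s1 = s2, t1 = t2 & m1 = m2].
Proof.
move=> h; elim: h s2 t2 m2 => {c s s1 t1 m1}.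
- by move=> s s2 t2 m2 h; inversion h.
- by move=> s s' x e -> s2 t2 m2 h; inversion h; subst.
- by move=> s s' a e -> s2 t2 m2 h; inversion h; subst.
- move=> c1 c2 a b d t1 t2 m1 m2 _ IH1 _ IH2 s2 t' m' h.
  inversion h as [| | |? ? ? ? ? ? ? ? ? h1 h2| |]; subst.
  by case: (IH1 _ _ _ h1) => ? ? ?; subst; case: (IH2 _ _ _ h2) => -> -> ->.
- move=> e c1 c2 s s' t m _ IH s2 t2 m2 h.
  inversion h as [| | | |? ? ? ? ? ? ? h1|]; subst.
  by case: (IH _ _ _ h1) => -> -> ->.
- move=> e c s s' t m _ IH s2 t2 m2 h.
  by inversion h as [| | | | |? ? ? ? ? ? h1]; subst; apply: IH.
Qed.

(* The input is the number of vertices followed by the rows of the adjacency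
   matrix, for the vertex order given by enum V. *)
Definition encode (V : finType) (G : graph V) : seq nat :=
  #|V| :: [seq nat_of_bool ([set u; v] \in edges G) | u <- enum V, v <- enum V].

Definition initial_state (V : finType) (G : graph V) :=
  State [::] (encode G).

Definition input_size (V : finType) (G : graph V) := cells_size (encode G).

Definition output (s : state) := nth 0 (regs s) 0.

(* Main.v *)
(* Pair the vertices 2 i and 2 i + 1 for i < k = n / 2.  For a matrix A put
   F_0 A = 1 and, eliminating the last pair u, v,
     F_(k+1) A = (1 + r A_uv) F_k (A + r D) - F_k A,
   where D_ij = A_ui A_vj + A_vi A_uj lets a matching edge ij pass through the
   pair.  Then F_k A = r ^ k haf A modulo r ^ (k + 1), over any commutative ring.
   For the induction step, apply the hypothesis over R[x] to A + x D: it reads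
   r ^ k p(x) + r ^ (k+1) h(x) with p = haf (A + x D), and subtracting the value
   at x = 0 from that at x = r leaves r ^ (k+1) p'(0) modulo r ^ (k+2), where
   p'(0) is the part of the hafnian in which u and v are not matched together.
   Unfolding the recursion gives a signed sum of 2 ^ k terms, one for each set of
   pairs, each computable in polynomial time and space.  Taking for r an integer
   that exceeds the number of perfect matchings and computing modulo
   r ^ (k + 1), the number is the total divided by r ^ k. *)

From HB Require Import structures.
From mathcomp Require Import all_boot all_order all_algebra.
From mathcomp Require Import zify ring.
Require Import Defs.

Set Implicit Arguments.
Unset Strict Implicit.
Unset Printing Implicit Defensive.

Import GRing.Theory.

(** * Hafnians *)

Section Delete.

Variable T : eqType.
Implicit Types (a b : T) (s : seq T).

Definition del a s := [seq x <- s | x != a].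

#[global] Arguments del : simpl never.

Lemma delC a b s : del a (del b s) = del b (del a s).
Proof. by rewrite /del -!filter_predI; apply: eq_filter => x /=; rewrite andbC. Qed.

Lemma del_notin a s : a \notin s -> del a s = s.
Proof.
move=> as'; apply/all_filterP/allP => x xs.
by apply: contraNneq as' => <-.
Qed.

Lemma del_head a s : a \notin s -> del a (a :: s) = s.
Proof. by move=> /del_notin; rewrite /del /= eqxx. Qed.

Lemma del_cons a b s : b != a -> del a (b :: s) = b :: del a s.
Proof. by rewrite /del /= => ->. Qed.

Lemma del_uniq a s : uniq s -> uniq (del a s).
Proof. exact: filter_uniq. Qed.

Lemma mem_del a b s : (a \in del b s) = (a != b) && (a \in s).
Proof. by rewrite mem_filter. Qed.

Lemma exchange_del (R : nmodType) s (f : T -> T -> R) :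
  (\sum_(a <- s) \sum_(b <- del a s) f a b =
   \sum_(b <- s) \sum_(a <- del b s) f a b)%R.
Proof.
under eq_bigr do rewrite big_filter.
under [RHS]eq_bigr do rewrite big_filter.
rewrite [LHS](exchange_big_dep xpredT) //=.
by apply: eq_bigr => b _; apply: eq_bigl => a; rewrite eq_sym.
Qed.

(** Separates the pairs in which [w] occurs from the others; in [coef1_haf], [w] is the vertex along
    which the hafnian is expanded. *)
Lemma sum_del_cons (R : nmodType) w s (f : T -> T -> R) : w \notin s ->
  (\sum_(a <- w :: s) \sum_(b <- del a (w :: s)) f a b =
   \sum_(b <- s) (f w b + f b w) + \sum_(a <- s) \sum_(b <- del a s) f a b)%R.
Proof.
move=> ws; rewrite big_cons del_head // big_split /= -addrA; congr (_ + _)%R.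
rewrite -big_split /=; apply: eq_big_seq => a sa.
by rewrite del_cons ?big_cons //; apply: contraNneq ws => ->.
Qed.

End Delete.

Local Open Scope ring_scope.

(* The hafnian of the rows and columns listed in s, which must be distinct and
   2 k in number for the result not to vanish. *)
Fixpoint haf (R : comNzRingType) (T : eqType) (A : T -> T -> R) k s : R :=
  match k, s with
  | 0, [::] => 1
  | k.+1, u :: s => \sum_(v <- s) A u v * haf A k (del v s)
  | _, _ => 0
  end.

(** The hafnian uses only ring operations on the entries. The case needed is evaluation of
    polynomial entries at a point. *)
Lemma rmorph_haf (R S : comNzRingType) (f : {rmorphism R -> S}) (T : eqType)
    (A : T -> T -> R) (B : T -> T -> S) k s :
  (forall i j, B i j = f (A i j)) -> haf B k s = f (haf A k s).
Proof.
move=> BA; elim: k s => [|k IH] [|u s] /=; rewrite ?rmorph0 ?rmorph1 //.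
by rewrite rmorph_sum; apply: eq_bigr => v _; rewrite rmorphM BA IH.
Qed.

Lemma haf_map (R : comNzRingType) (T U : eqType) (g : T -> U)
    (A : U -> U -> R) (B : T -> T -> R) k s :
    {in s &, injective g} -> {in s &, forall i j, B i j = A (g i) (g j)} ->
  haf A k (map g s) = haf B k s.
Proof.
elim: k s => [|k IH] [|u s] //= gI BA; rewrite big_map; apply: eq_big_seq => v vs.
have sub : {subset del v s <= u :: s}.
  by move=> x; rewrite mem_del inE orbC => /andP[_ ->].
rewrite BA ?mem_head ?inE ?vs ?orbT // -IH.
- congr (_ * haf _ _ _); rewrite /del filter_map; congr map.
  apply: eq_in_filter => x xs /=; apply/negb_inj; rewrite !negbK.
  by apply/eqP/eqP => [/gI ->|->] //; rewrite inE ?xs ?vs orbT.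
- by move=> x y /sub xs /sub ys; apply: gI.
- by move=> x y /sub xs /sub ys; apply: BA.
Qed.

(** * Eliminating one pair of vertices *)

Section Elimination.

Variables (R : comNzRingType) (T : eqType) (u v : T).

Definition cross (A : T -> T -> R) i j := A u i * A v j + A v i * A u j.

(** Either [u] is matched to [v], or [u] to some [i] and [v] to some [j]. The second case takes two
    edges, hence needs [k > 0]. *)
Lemma haf_cons2 (A : T -> T -> R) k s : u != v -> u \notin s -> v \notin s ->
  haf A k.+1 [:: u, v & s] =
  A u v * haf A k s +
  (if k is k'.+1 then
     \sum_(i <- s) \sum_(j <- del i s) A u i * A v j * haf A k' (del j (del i s))
   else 0).
Proof.
move=> uv us vs /=; rewrite big_cons del_head //; congr (_ + _).
case: k => [|k].
  rewrite big1_seq // => i /andP[_ si]; rewrite del_cons ?mulr0 //.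
  by apply: contraNneq vs => ->.
apply: eq_big_seq => i si; rewrite del_cons /=; last first.
  by apply: contraNneq vs => ->.
by rewrite mulr_sumr; apply: eq_bigr => j _; rewrite mulrA.
Qed.

Definition shift (A : T -> T -> R) i j := (A i j)%:P + (cross A i j)%:P * 'X.

Lemma horner_shift (A : T -> T -> R) x i j :
  (shift A i j).[x] = A i j + cross A i j * x.
Proof. by rewrite !hornerE. Qed.

Lemma coef0_haf (A : T -> T -> R) k s : (haf (shift A) k s)`_0 = haf A k s.
Proof.
rewrite -horner_coef0 -[_.[0]]/(horner_eval 0 _).
rewrite -(@rmorph_haf _ _ (horner_eval 0) _ _ A) // => i j.
by rewrite [RHS]horner_shift mulr0 addr0.
Qed.

(* The coefficient is the part of the hafnian of u :: v :: s in which u and v are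
   not matched to each other; see [haf_cons2]. *)
Lemma coef1_haf (A : T -> T -> R) k s : uniq s ->
  (haf (shift A) k s)`_1 =
  if k is k'.+1 then
    \sum_(i <- s) \sum_(j <- del i s) A u i * A v j * haf A k' (del j (del i s))
  else 0.
Proof.
elim: k s => [|k IH] [|w s] /=; rewrite ?coef0 ?coef1 ?big_nil //.
case/andP=> ws us.
rewrite sum_del_cons // coef_sum.
(* For pairs avoiding [w], expand the remaining hafnian along [w], matched to [c], and move the sum
   over [c] outermost; the inner sums then have the form of the induction hypothesis for
   [del c s]. *)
have -> : \sum_(a <- s) \sum_(b <- del a s) A u a * A v b *
     haf A k (del b (del a (w :: s))) =
   \sum_(c <- s) A w c * (if k is k'.+1 then \sum_(a <- del c s)
      \sum_(b <- del a (del c s)) A u a * A v b * haf A k' (del b (del a (del c s)))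
      else 0).
  case: k {IH} => [|k].
    rewrite big1_seq => [|a /andP[_ sa]]; last first.
      rewrite big1_seq // => b /andP[_]; rewrite mem_del => /andP[_ sb].
      by rewrite !del_cons ?mulr0 //; apply: contraNneq ws => ->.
    by rewrite big1 // => c _; rewrite mulr0.
  under [RHS]eq_bigr do rewrite mulr_sumr.
  rewrite [RHS]exchange_del; apply: eq_big_seq => a sa.
  under [RHS]eq_bigr => c _.
    rewrite mulr_sumr delC; over.
  rewrite [RHS]exchange_del; apply: eq_big_seq => b.
  rewrite mem_del => /andP[_ sb].
  rewrite !del_cons /=; try by apply: contraNneq ws => ->.
  rewrite mulr_sumr; apply: eq_bigr => c _.
  by rewrite (delC c b) mulrCA.
rewrite -big_split /=; apply: eq_big_seq => c sc.
have wc : w != c by apply: contraNneq ws => ->.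
(* Product rule: the linear coefficient of the entry at [w], [c] gives the pairs containing [w], and
   the linear coefficient of the remaining hafnian gives those avoiding it. *)
rewrite coefM !big_ord_recl big_ord0 /= /bump /= coef0_haf IH ?del_uniq //.
rewrite !coefD !coefC !coefMX !coefC /= !addr0 add0r.
rewrite del_head // [del w (del c _)]delC del_head //.
by rewrite addrC /cross mulrDl [A v w * _]mulrC.
Qed.

End Elimination.

(** * The signed recursion and its congruence with the hafnian *)

Fixpoint vertices k := if k is k.+1 then [:: k.*2, k.*2.+1 & vertices k] else [::].

Lemma mem_vertices k i : (i \in vertices k) = (i < k.*2)%N.
Proof. by elim: k => //= k IH; rewrite !inE IH doubleS; lia. Qed.

Lemma vertices_uniq k : uniq (vertices k).
Proof. by elim: k => //= k IH; rewrite !inE !mem_vertices IH; lia. Qed.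

(** The matrix [shift] evaluated at [c]. Keeping [c] general covers both branches of the recursion,
    [c = r] and [c = 0]. *)
Definition bump_mx (R : comNzRingType) (c : R) k (A : nat -> nat -> R) i j :=
  A i j + c * cross k.*2 k.*2.+1 A i j.

Fixpoint sieve (R : comNzRingType) (r : R) k (A : nat -> nat -> R) : R :=
  if k is k.+1 then
    (1 + r * A k.*2 k.*2.+1) * sieve r k (bump_mx r k A) - sieve r k A
  else 1.

Lemma rmorph_sieve (R S : comNzRingType) (f : {rmorphism R -> S}) r A B k :
  (forall i j, B i j = f (A i j)) -> sieve (f r) k B = f (sieve r k A).
Proof.
elim: k A B => [|k IH] A B BA /=; first by rewrite rmorph1.
rewrite rmorphB !rmorphM rmorphD rmorph1 rmorphM BA (IH A B) //.
rewrite (IH (bump_mx r k A)) // => i j.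
by rewrite /bump_mx /cross !BA rmorphD rmorphM rmorphD !rmorphM.
Qed.

Lemma horner_taylor1 (R : comNzRingType) (p : {poly R}) (x : R) :
  exists q, p.[x] = p`_0 + x * p`_1 + x ^+ 2 * q.
Proof.
elim/poly_ind: p => [|p c [q pq]].
  by exists 0; rewrite horner0 !coef0 !mulr0 !addr0.
exists (p`_1 + x * q); rewrite hornerMXaddC pq !coefD !coefMX !coefC /=.
ring.
Qed.

(** The ring is generalised in the induction, because the step over [R] uses the hypothesis over
    polynomials, with [r] as a constant. Since [vertices] lists the last pair first, [haf_cons2]
    applies to the pair being eliminated. *)
Lemma sieve_haf k (R : comNzRingType) (r : R) (A : nat -> nat -> R) :
  exists h, sieve r k A = r ^+ k * haf A k (vertices k) + r ^+ k.+1 * h.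
Proof.
elim: k R r A => [|k IH] R r A; first by exists 0; rewrite mulr0 addr0 mulr1.
set u := k.*2; set v := k.*2.+1; set s := vertices k.
have [h Ph] := IH _ r%:P (shift u v A).
(* Evaluation at [x] is a morphism fixing the constant [r], so the polynomial identity specialises
   at every [x]; only [x = r] and [x = 0] are used. *)
have ev x B : (forall i j, B i j = (shift u v A i j).[x]) ->
    sieve r k B = r ^+ k * (haf (shift u v A) k s).[x] + r ^+ k.+1 * h.[x].
  move=> BA; have := @rmorph_sieve _ _ (horner_eval x) r%:P _ B k BA.
  by rewrite /= Ph !horner_evalE hornerC => ->; rewrite !hornerE.
rewrite /= (ev r (bump_mx r k A)); last first.
  by move=> i j; rewrite horner_shift /bump_mx mulrC.
rewrite (ev 0); last by move=> i j; rewrite horner_shift mulr0 addr0.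
have [q ->] := horner_taylor1 (haf (shift u v A) k s) r.
have [q' ->] := horner_taylor1 h r.
rewrite !horner_coef0 coef0_haf coef1_haf ?vertices_uniq //.
rewrite -[\sum_(_ <- _ :: _) _]/(haf A k.+1 [:: u, v & s]) haf_cons2; first last.
- by rewrite mem_vertices; lia.
- by rewrite mem_vertices; lia.
- by lia.
rewrite -/u -/v !exprS.
match goal with |- context [A u v * haf A k s + ?d] => set D := d end.
(* The first three terms remain from the difference of the values at [r] and [0]; the multiple of
   [A u v] comes from the factor [1 + r * A u v], once its leading part [A u v * haf A k s] has
   joined the hafnian. *)
exists (q + h`_1 + r * q' + A u v * (D + r * q + h`_0 + r * h`_1 + r ^+ 2 * q')).
ring.
Qed.

(** * Unfolding the recursion into a sum over sets of pairs *)

Section Subsets.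

Variables (R : comNzRingType) (r : R).

(* The binary digits of X, lowest first, select pairs, last pair first. *)
Fixpoint sieve_term k (X : nat) (A : nat -> nat -> R) : R :=
  if k is k.+1 then
    ((1 - (X %% 2)%:R) * -1 + (X %% 2)%:R * (1 + r * A k.*2 k.*2.+1)) *
    sieve_term k (X %/ 2) (bump_mx ((X %% 2)%:R * r) k A)
  else 1.

(** Odd [X] select the last pair and give the first branch of [sieve], even [X] give the subtracted
    one; [X %/ 2] encodes the choices for the other pairs. *)
Lemma sum_sieve_term k A : \sum_(0 <= X < 2 ^ k) sieve_term k X A = sieve r k A.
Proof.
have double m (f : nat -> R) :
    \sum_(0 <= X < m.*2) f X = \sum_(0 <= X < m) (f X.*2 + f X.*2.+1).
  elim: m => [|m IH]; first by rewrite !big_geq.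
  by rewrite doubleS !big_nat_recr //= IH addrA.
elim: k A => [|k IH] A; first by rewrite big_nat1.
rewrite expnS mul2n double big_split /= addrC.
rewrite -(IH (bump_mx r k A)) mulr_sumr -[sieve r k A]mul1r -mulNr.
have -> : sieve r k A = sieve r k (bump_mx (0 * r) k A).
  (* With the identity morphism, [rmorph_sieve] is extensionality in the matrix. *)
  by apply: (@rmorph_sieve R R idfun r) => i j; rewrite /bump_mx !mul0r addr0.
rewrite -IH mulr_sumr; congr (_ + _); apply: eq_bigr => X _.
  rewrite -addn1 -muln2 modnMDl divnMDl // addn0 /= mul1r.
  by rewrite subrr mul0r add0r mul1r.
by rewrite -muln2 modnMl mulnK //= subr0 mul0r addr0 mul1r.
Qed.

End Subsets.

(** * Perfect matchings *)

Section Matchings.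

Variables (V : finType) (G : graph V).
Implicit Types (S : {set V}) (M : {set {set V}}) (u v : V).

(** Perfect matchings of the subgraph induced by [S], so that vertices can be removed in a
    recursion; on the full set this agrees with [perfect_matching] by conversion. *)
Definition matchings_of S :=
  [set M : {set {set V}} | [&& M \subset edges G, trivIset M & cover M == S]].

Lemma matching_edge M e : M \subset edges G -> e \in M -> #|e| = 2.
Proof. by move=> /subsetP ME /ME; apply: edges_card2. Qed.

(** The block of [M] containing [u] is an edge, and its other end is the only partner of [u]. *)
Lemma partner_sum S M u : M \in matchings_of S -> u \in S ->
  (\sum_(v in S :\ u) ([set u; v] \in M) = 1)%N.
Proof.
rewrite inE => /and3P[ME tM /eqP cM] uS.
have uM : u \in cover M by rewrite cM.
have eM := pblock_mem uM; have ue : u \in pblock M u by rewrite mem_pblock.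
have /cards2P[a [b [ab eab]]] : #|pblock M u| == 2 by rewrite (matching_edge ME eM).
have [v uv ev] : exists2 v, v != u & pblock M u = [set u; v].
  move: ue; rewrite eab !inE => /orP[] /eqP ->; first by exists b; rewrite // eq_sym.
  by exists a; rewrite // setUC.
have vS : v \in S :\ u.
  rewrite !inE uv -cM; apply/bigcupP; exists (pblock M u) => //.
  by rewrite ev !inE eqxx orbT.
rewrite (bigD1 v) //= -ev eM big1 // => w /andP[_ wv].
apply/eqP; rewrite eqb0; apply: contra wv => wM.
have : w \in pblock M u by rewrite (def_pblock tM wM) !inE eqxx ?orbT.
rewrite ev !inE => /orP[] // /eqP wu.
have := matching_edge ME wM; by rewrite wu setUid cards1.
Qed.

(** Adding the edge is a bijection from the matchings of the smaller set onto those of [S] that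
    contain it; removing it is the inverse. *)
Lemma card_matchings_edge S u v : u \in S -> v \in S -> u != v ->
  #|[set M in matchings_of S | [set u; v] \in M]| =
  (([set u; v] \in edges G) * #|matchings_of (S :\ u :\ v)|)%N.
Proof.
move=> uS vS uv; set e := [set u; v].
have [eE|eE] := boolP (e \in edges G); last first.
  rewrite mul0n; apply/eqP; rewrite cards_eq0; apply/eqP/setP => M; rewrite !inE.
  apply: contraNF eE => /andP[/and3P[/subsetP ME _ _]]; exact: ME.
rewrite mul1n.
have S'E : S :\ u :\ v = S :\: e.
  by apply/setP => x; rewrite !inE negb_or; case: (x == u); case: (x == v).
have eS : e \subset S by apply/subsetP => x; rewrite !inE => /orP[] /eqP ->.
have eM' M : cover M = S :\: e -> e \notin M.
  move=> cM; apply/negP => eM.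
  have : u \in cover M by apply/bigcupP; exists e; rewrite // !inE eqxx.
  by rewrite cM !inE eqxx.
rewrite -(card_in_imset (f := fun M => e |: M) (D := ssrbool.mem (matchings_of _))); last first.
  move=> M1 M2; rewrite !inE S'E => /and3P[_ _ /eqP/eM' e1] /and3P[_ _ /eqP/eM' e2] E.
  by rewrite -(setU1K e1) -(setU1K e2) E.
congr #|pred_of_set _|; apply/setP => M; apply/idP/imsetP.
  rewrite !inE => /andP[/and3P[ME tM /eqP cM] eM].
  exists (M :\ e); last by rewrite setD1K.
  rewrite inE S'E (subset_trans (subD1set _ _) ME) (trivIsetS (subD1set _ _) tM) /=.
  apply/eqP/setP => x; rewrite inE -cM; apply/bigcupP/andP.
    case=> f; rewrite !inE => /andP[fe fM] xf; split; last by apply/bigcupP; exists f.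
    have /trivIsetP/(_ _ _ fM eM fe) := tM.
    by rewrite -setI_eq0 => /eqP/setP/(_ x); rewrite !inE xf /= => ->.
  case=> xe /bigcupP[f fM xf]; exists f => //; rewrite !inE fM andbT.
  by apply: contraNneq xe => <-.
case=> N; rewrite !inE S'E => /and3P[NE tN /eqP cN] ->.
have eN := eM' _ cN.
have cE : cover (e |: N) = S.
  rewrite /cover big_setU1 //= -/(cover N) cN; apply/setP => x; rewrite !inE.
  by move/subsetP/(_ x): eS; rewrite !inE; case: (x \in S);
    case: (x == u); case: (x == v) => //= /(_ isT).
rewrite !inE cE eqxx subUset sub1set eE NE eqxx /= !andbT.
have dis : {in N, forall B : {set V}, [disjoint e & B]}.
  move=> B BN; rewrite -setI_eq0; apply/eqP/setP => x; rewrite !inE.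
  apply/negP => /andP[xe xB].
  have : x \in cover N by apply/bigcupP; exists B.
  by rewrite cN !inE xe.
have n0 : set0 \notin N by apply/negP => /(matching_edge NE); rewrite cards0.
by have [] := trivIsetU1 dis tN n0.
Qed.

(** Double counting of matchings with the partner of [u]. This is the counterpart of expanding a
    hafnian along its first entry. *)
Lemma card_matchings_rec S u : u \in S ->
  #|matchings_of S| =
  (\sum_(v in S :\ u) ([set u; v] \in edges G) * #|matchings_of (S :\ u :\ v)|)%N.
Proof.
move=> uS; rewrite -sum1_card.
under eq_bigr => M MS do rewrite -(partner_sum MS uS).
rewrite exchange_big /=; apply: eq_bigr => v; rewrite !inE => /andP[vu vS].
rewrite -card_matchings_edge // 1?eq_sym // -sum1_card big_mkcond [RHS]big_mkcond /=.
by apply: eq_bigr => M _; rewrite !inE; case: ifP => //= _; case: (_ \in M).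
Qed.

Lemma haf_matchings (R : comNzRingType) k (s : seq V) :
    uniq s -> size s = k.*2 ->
  #|matchings_of [set x in s]|%:R =
  haf (fun u v => ([set u; v] \in edges G)%:R : R) k s.
Proof.
elim: k s => [|k IH] [|u s] //= us.
  move=> _; have -> : matchings_of [set x in [::]] = [set set0].
    apply/setP => M; rewrite !inE; apply/and3P/eqP => [[ME _ /eqP cM]|->].
      apply/eqP; rewrite -subset0; apply/subsetP => e eM.
      have := matching_edge ME eM; have : e \subset cover M by apply: bigcup_sup.
      rewrite cM => /subset_leq_card; have -> : [set x in [::]] = set0 :> {set V}.
        by apply/setP => x; rewrite !inE.
      by rewrite cards0 leqn0 => /eqP ->.
    split; first exact: sub0set.
      by apply/trivIsetP => A B; rewrite inE.
    by apply/eqP/setP => x; rewrite /cover big_set0 !inE.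
  by rewrite cards1.
case/andP: us => us' us [sz].
have uS : u \in [set x in u :: s] by rewrite inE mem_head.
rewrite (card_matchings_rec uS) natr_sum.
have -> : [set x in u :: s] :\ u = [set x in s].
  by apply/setP => x; rewrite !inE; case: eqP => // ->; rewrite (negPf us').
rewrite (eq_bigl (ssrbool.mem s)) => [|x]; last by rewrite inE.
rewrite -big_uniq //=; apply: eq_big_seq => v vs; rewrite natrM; congr (_ * _).
have -> : [set x in s] :\ v = [set x in del v s].
  by apply/setP => x; rewrite !inE mem_del.
apply: IH; first exact: del_uniq.
by rewrite /del -rem_filter // size_rem // sz.
Qed.

Lemma matchings_odd S : odd #|S| -> matchings_of S = set0.
Proof.
move=> oS; apply/setP => M; rewrite !inE; apply: contraTF oS => /and3P[ME tM /eqP <-].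
rewrite -(eqP tM) (eq_bigr (fun=> 2)) ?sum_nat_const ?oddM ?andbF // => e.
exact: matching_edge.
Qed.

(** A matching is a set of edges, and every edge comes from an ordered pair of vertices. The bound
    is the integer [r] that the program uses. *)
Lemma card_matchings_lt S : (#|matchings_of S| < 2 ^ (#|V| * #|V|).+1)%N.
Proof.
have dE : (#|edges G| <= #|V| * #|V|)%N.
  rewrite -card_prod -cardsT; apply: leq_trans (leq_imset_card (fun x => [set x.1; x.2]) _).
  apply/subset_leq_card/subsetP => e eE.
  have /cards2P[a [b [_ ->]]] : #|e| == 2 by rewrite (edges_card2 eE).
  by apply/imsetP; exists (a, b).
apply: leq_ltn_trans (_ : #|powerset (edges G)| < _)%N.
  by apply/subset_leq_card/subsetP => M; rewrite !inE => /and3P[].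
by rewrite card_powerset ltn_exp2l // ltnS.
Qed.

End Matchings.

Local Close Scope ring_scope.

(** * Time and space of commands *)

Lemma bits_leq L k : (bits k <= L) = (k < 2 ^ L).
Proof.
apply/idP/idP => [|kL]; last exact: up_log_min.
by move=> kL; apply: leq_trans (up_logP k.+1 (ltnSn 1)) _; rewrite leq_exp2l.
Qed.

(** A constant is weighted by its value, so that [L * esize e] bounds the length of the value of
    [e]. *)
Fixpoint esize (e : expr) : nat :=
  match e with
  | Cst k => k.+1
  | Reg _ => 1
  | Mem a => (esize a).+1
  | Bin _ e1 e2 => (esize e1 + esize e2).+1
  end.

Section Costs.

(* L bounds the length of every stored number, K the number of memory cells,
   nreg the number of registers and E the size of every expression. *)
Variables (L K nreg E : nat).
Hypothesis L_gt0 : 0 < L.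

Definition good (s : state) :=
  [/\ size (regs s) <= nreg, size (mem s) <= K,
      forall i, nth 0 (regs s) i < 2 ^ L & forall i, nth 0 (mem s) i < 2 ^ L].

(** A sum or product is no longer than its operands together, plus the extra [L]; the other
    operations never exceed their first operand. *)
Lemma eval_lt s e : good s -> eval s e < 2 ^ (L * esize e).
Proof.
case=> _ _ hr hm.
elim: e => [k|x|a _|o e1 IH1 e2 IH2] /=.
- apply: leq_trans (ltn_expl k (ltnSn 1)) _; rewrite leq_exp2l //; nia.
- by rewrite muln1.
- by apply: leq_trans (hm _) _; rewrite leq_exp2l //; nia.
have le1 : eval s e1 < 2 ^ (L * (esize e1 + esize e2).+1).
  by apply: leq_trans IH1 _; rewrite leq_exp2l //; nia.
case: o => /=; last 1 first.
- by apply: leq_ltn_trans le1; exact: leq_mod.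
- rewrite mulnS mulnDr !expnD.
  have : 0 < 2 ^ L by rewrite expn_gt0.
  move: (2 ^ L) (2 ^ (L * esize e1)) (2 ^ (L * esize e2)) (eval s e1) (eval s e2) IH1 IH2
    => a b c x y xb yc a0.
  by apply: (@leq_trans (b * c)); [nia | rewrite leq_pmull].
- by apply: leq_ltn_trans le1; exact: leq_subr.
- rewrite mulnS mulnDr !expnD.
  have : 0 < 2 ^ L by rewrite expn_gt0.
  move: (2 ^ L) (2 ^ (L * esize e1)) (2 ^ (L * esize e2)) (eval s e1) (eval s e2) IH1 IH2
    => a b c x y xb yc a0.
  by apply: (@leq_trans (b * c)); [exact: ltn_mul | rewrite leq_pmull].
- by apply: leq_ltn_trans le1; exact: leq_div.
Qed.

Lemma eval_cost_leq s e : good s -> esize e <= E ->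
  eval_cost s e <= esize e * (L * E).+1.
Proof.
move=> gs; have step e' : esize e' <= E -> (bits (eval s e')).+1 <= (L * E).+1.
  move=> eE; rewrite ltnS bits_leq; apply: leq_trans (eval_lt e' gs) _.
  by rewrite leq_exp2l // leq_mul2l eE orbT.
elim: e => [k|x|a IH|o e1 IH1 e2 IH2] eE /=; have := step _ eE => /=.
- by rewrite addn0 => /leq_trans; apply; rewrite leq_pmull.
- by rewrite addn0 mul1n.
- by move=> h; rewrite mulSn leq_add // IH // ltnW.
- move=> h; rewrite mulSn mulnDl !leq_add // ?IH1 ?IH2 //.
    by move: eE => /=; lia.
  by move: eE => /=; lia.
Qed.

Definition step_cost := (2 * (E * (L * E).+1)).+2.
(** The stored state, plus the intermediate values of one command. *)
Definition space_bound := (nreg + K) * L.+1 + step_cost.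

Lemma state_size_leq s : good s -> state_size s <= (nreg + K) * L.+1.
Proof.
case=> sr sm hr hm; rewrite /state_size /cells_size mulnDl.
have aux (l : seq nat) b : size l <= b -> (forall i, nth 0 l i < 2 ^ L) ->
    \sum_(k <- l) (bits k).+1 <= b * L.+1.
  move=> lb hl; apply: leq_trans (_ : size l * L.+1 <= _); last by rewrite leq_mul2r lb orbT.
  rewrite (big_nth 0) -[X in X * _]subn0 -sum_nat_const_nat.
  by apply: leq_sum => i _; rewrite ltnS bits_leq.
by apply: leq_add; apply: aux.
Qed.

(* T counts elementary steps, each of which costs at most step_cost. *)
Definition runs T c s (Q : state -> Prop) :=
  good s -> exists s' t m,
  [/\ exec c s s' t m, t <= T * step_cost, m <= space_bound, good s' & Q s'].

(** Makes the size bounds on the current state available while a run is being derived. *)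
Lemma runs_good T c s Q : (good s -> runs T c s Q) -> runs T c s Q.
Proof. by move=> h gs; apply: h. Qed.

Lemma runs_weaken T T' c s (Q Q' : state -> Prop) :
  T <= T' -> (forall s', Q s' -> Q' s') -> runs T c s Q -> runs T' c s Q'.
Proof.
move=> TT QQ h /h[s' [t [m [ex tT mM gs' Qs']]]]; exists s', t, m; split=> //; last exact: QQ.
by apply: leq_trans tT _; rewrite leq_mul2r TT orbT.
Qed.

Lemma cost1 s e : good s -> esize e <= E -> (eval_cost s e).+2 <= step_cost.
Proof.
move=> gs eE; have := eval_cost_leq gs eE; rewrite /step_cost => h.
apply: leq_trans (_ : (E * (L * E).+1).+2 <= _); last by lia.
by rewrite !ltnS; apply: leq_trans h _; rewrite leq_mul2r eE orbT.
Qed.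

Lemma nth_set_nth_lt (l : seq nat) a v b :
  (forall i, nth 0 l i < b) -> v < b -> forall i, nth 0 (set_nth 0 l a v) i < b.
Proof. by move=> hl vb i; rewrite nth_set_nth /=; case: eqP. Qed.

Lemma runs_set x e s (Q : state -> Prop) :
    esize e <= E -> x < nreg -> eval s e < 2 ^ L -> Q (set_reg s x (eval s e)) ->
  runs 1 (SetReg x e) s Q.
Proof.
move=> eE xr vL Qs gs; have [sr sm hr hm] := gs; have c1 := cost1 gs eE.
have gs' : good (set_reg s x (eval s e)).
  split=> //=; first by rewrite size_set_nth geq_max xr.
  exact: nth_set_nth_lt.
exists (set_reg s x (eval s e)); do 2!eexists; split; first exact: ExecSetReg.
- by rewrite mul1n ltnW.
- have := state_size_leq gs; have := state_size_leq gs'.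
  by rewrite /space_bound geq_max => ? ?; lia.
- by [].
- by [].
Qed.

Lemma runs_mem a e s (Q : state -> Prop) :
    esize a + esize e <= E -> eval s a < K -> eval s e < 2 ^ L ->
    Q (set_mem s (eval s a) (eval s e)) ->
  runs 1 (SetMem a e) s Q.
Proof.
move=> aeE aK vL Qs gs; have [sr sm hr hm] := gs.
have aE : esize a <= E by lia.
have eE : esize e <= E by lia.
have c1 : (eval_cost s a + eval_cost s e).+1 <= step_cost.
  have := eval_cost_leq gs aE; have := eval_cost_leq gs eE.
  have : (esize a + esize e) * (L * E).+1 <= E * (L * E).+1 by rewrite leq_mul2r aeE orbT.
  by rewrite /step_cost mulnDl; lia.
have gs' : good (set_mem s (eval s a) (eval s e)).
  split=> //=; first by rewrite size_set_nth geq_max aK.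
  exact: nth_set_nth_lt.
exists (set_mem s (eval s a) (eval s e)); do 2!eexists; split; first exact: ExecSetMem.
- by rewrite mul1n.
- have := state_size_leq gs; have := state_size_leq gs'.
  by rewrite /space_bound geq_max => ? ?; lia.
- by [].
- by [].
Qed.

Lemma runs_seq T1 T2 c1 c2 s Q :
  runs T1 c1 s (fun s' => runs T2 c2 s' Q) -> runs (T1 + T2) (Seq c1 c2) s Q.
Proof.
move=> h gs; have [s1 [t1 [m1 [e1 l1 b1 g1 h1]]]] := h gs.
have [s2 [t2 [m2 [e2 l2 b2 g2 h2]]]] := h1 g1.
exists s2, (t1 + t2), (maxn m1 m2); split=> //; first exact: ExecSeq e1 e2.
  by rewrite mulnDl leq_add.
by rewrite geq_max b1.
Qed.

Lemma runs_set_seq T x e c s Q :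
    esize e <= E -> x < nreg -> eval s e < 2 ^ L ->
    runs T c (set_reg s x (eval s e)) Q ->
  runs T.+1 (Seq (SetReg x e) c) s Q.
Proof. by move=> *; rewrite -add1n; apply: runs_seq; apply: runs_set. Qed.

Definition Repeat x body :=
  While (Reg x) (Seq (SetReg x (Bin Sub (Reg x) (Cst 1))) body).

(** [I i] is the invariant with [i] iterations left; the body already sees the decremented counter.
    Test and decrement add two steps to each iteration, and the last failing test is one more. The
    decrement expression has size 4. *)
Lemma runs_repeat T x body (I : nat -> state -> Prop) j s :
    4 <= E -> x < nreg -> (forall i s', I i s' -> nth 0 (regs s') x = i) ->
    (forall i s', i < j -> I i.+1 s' -> runs T body (set_reg s' x i) (I i)) ->
    I j s ->
  runs (j * T.+2 + 1) (Repeat x body) s (I 0).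
Proof.
move=> E4 xr Ix step Is gs; elim: j s step Is gs => [|j IH] s step Is gs.
  have ev : eval s (Reg x) = 0 by rewrite /= (Ix _ _ Is).
  exists s, ((eval_cost s (Reg x)).+1 + 1).
  exists (maxn (state_size s + eval_cost s (Reg x)) (state_size s)); split=> //.
  - by apply/ExecWhile/ExecIf; rewrite ev; exact: ExecSkip.
  - by rewrite addn1 mul1n; apply: cost1 => //; apply: leq_trans E4.
  - have := state_size_leq gs; have := cost1 gs (leq_trans (isT : esize (Reg x) <= 4) E4).
    by rewrite /space_bound geq_max => ? ?; lia.
have ev : eval s (Reg x) = j.+1 by rewrite /= (Ix _ _ Is).
have ev' : eval s (Bin Sub (Reg x) (Cst 1)) = j by rewrite /= (Ix _ _ Is) subn1.
have jL : j.+1 < 2 ^ L by rewrite -(Ix _ _ Is); case: gs.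
have [] : runs T.+1 (Seq (SetReg x (Bin Sub (Reg x) (Cst 1))) body) s (I j).
- apply: runs_set_seq => //; rewrite ev'; first exact: ltnW.
  exact: step.
- by [].
move=> s1 [t1 [m1 [e1 l1 b1 g1 I1]]].
have [|s2 [t2 [m2 [e2 l2 b2 g2 I2]]]] := IH s1 _ I1 g1.
  by move=> i s' ij; apply: step; rewrite ltnS ltnW.
have cR := cost1 gs (leq_trans (isT : esize (Reg x) <= 4) E4).
exists s2; do 2!eexists; split.
- by apply: ExecWhile; apply: ExecIf; rewrite ev; apply: ExecSeq e1 e2.
- have -> : j.+1 * T.+2 + 1 = 1 + (T.+1 + (j * T.+2 + 1)) by lia.
  by rewrite 2!mulnDl mul1n; apply: leq_add; [exact: ltnW | apply: leq_add].
- have := state_size_leq gs; have := cR.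
  by rewrite /space_bound !geq_max b1 b2 /= andbT => ? ?; lia.
- exact: g2.
- exact: I2.
Qed.

End Costs.

(** * The program *)

Declare Scope expr_scope.
Delimit Scope expr_scope with expr.
Notation "x + y" := (Bin Add x y) : expr_scope.
Notation "x - y" := (Bin Sub x y) : expr_scope.
Notation "x * y" := (Bin Mul x y) : expr_scope.
Notation "x %/ y" := (Bin Div x y) : expr_scope.
Notation "x %% y" := (Bin Mod x y) : expr_scope.
Notation "$ x" := (Reg x) (at level 1, x at level 0, format "$ x").
Notation "# x" := (Cst x) (at level 1, x at level 0, format "# x").
Notation "x <~ e" := (SetReg x e%expr) (at level 70).
Notation "c1 ;; c2" := (Seq c1 c2) (at level 90, right associativity).

(* The cells 0 .. n ^ 2 hold the input; the next n ^ 2 cells hold the working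
   matrix. *)
Definition work_base := (#1 + $1 * $1)%expr.
Definition cell_addr i j := (work_base + ($1 * i + j))%expr.
Definition cell i j := Mem (cell_addr i j).

Definition copy_body := SetMem (work_base + $10)%expr (Mem (#1 + $10)%expr).

Definition fst_vertex := (#2 * $9)%expr.
Definition snd_vertex := (fst_vertex + #1)%expr.
(** The counter runs over the index pairs below [2 l], read as two digits in base [2 l]. *)
Definition counter_row := ($10 %/ fst_vertex)%expr.
Definition counter_col := ($10 %% fst_vertex)%expr.

(* Only entries with both indices below 2 l change, so the rows 2 l and 2 l + 1
   that are read keep their old values. *)
Definition update_body :=
  SetMem (cell_addr counter_row counter_col)
    ((cell counter_row counter_col +
      $11 * $3 * (cell fst_vertex counter_row * cell snd_vertex counter_col +
                  cell snd_vertex counter_row * cell fst_vertex counter_col)) %% $5)%expr.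

(* Modulo N, the factor N - 1 is the sign of a pair outside the subset. *)
Definition level_body :=
  11 <~ $7 %% #2 ;;
  7 <~ $7 %/ #2 ;;
  8 <~ $8 * ((#1 - $11) * ($5 - #1) + $11 * (#1 + $3 * cell fst_vertex snd_vertex)) %% $5 ;;
  10 <~ fst_vertex * fst_vertex ;;
  Repeat 10 update_body.

(** Each subset starts from a fresh copy of the input matrix, so one working matrix suffices and no
    recursion stack is stored. *)
Definition subset_body :=
  7 <~ $6 ;;
  8 <~ #1 ;;
  10 <~ $1 * $1 ;;
  Repeat 10 copy_body ;;
  9 <~ $2 ;;
  Repeat 9 level_body ;;
  0 <~ ($0 + $8) %% $5.

(* Registers: 0 total, 1 n, 2 k, 3 r, 4 r ^ k, 5 modulus, 6 subset,
   7 unread bits of the subset, 8 current product, 9 level, 10 counter, 11 bit.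
   Writing register 11 first makes the register list have length 12 throughout. *)
Definition program :=
  11 <~ #0 ;;
  1 <~ Mem #0 ;;
  2 <~ $1 %/ #2 ;;
  3 <~ #1 ;; 10 <~ $1 * $1 + #1 ;; Repeat 10 (3 <~ $3 * #2) ;;
  4 <~ #1 ;; 10 <~ $2 ;; Repeat 10 (4 <~ $4 * $3) ;;
  5 <~ $4 * $3 ;;
  6 <~ #1 ;; 10 <~ $2 ;; Repeat 10 (6 <~ $6 * #2) ;;
  Repeat 6 subset_body ;;
  0 <~ (#1 - $1 %% #2) * ($0 %/ $4).

(** * Verification of the loops of the program *)

Section Program.

Variables (n : nat) (m0 : seq nat) (L : nat).
Let k := n %/ 2.
Let r := 2 ^ (n * n + 1).
Let N := r ^ k * r.
Let K := 1 + n * n + n * n.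

Hypothesis m0n : nth 0 m0 0 = n.
Hypothesis NL : N < 2 ^ L.
Hypothesis KL : K < 2 ^ L.

Let addr i j := 1 + n * n + (n * i + j).

(* 12 registers are used, and no expression of the program has size above 300. *)
Local Notation run := (runs L K 12 300).

Lemma L_pos : 0 < L. Proof. by move: KL; case: L. Qed.
Lemma r_ge2 : 2 <= r. Proof. by rewrite /r addn1 expnS leq_pmulr // expn_gt0. Qed.
Lemma rk_gt0 : 0 < r ^ k. Proof. by rewrite expn_gt0 (ltnW r_ge2). Qed.
Lemma N_ge2 : 2 <= N.
Proof. by apply: leq_trans r_ge2 _; rewrite leq_pmull ?rk_gt0. Qed.

Lemma small_lt a : a <= 2 -> a < 2 ^ L.
Proof. by move=> a2; apply: leq_ltn_trans NL; apply: leq_trans N_ge2. Qed.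

Lemma r_lt : r < 2 ^ L.
Proof. by apply: leq_ltn_trans NL; rewrite leq_pmull ?rk_gt0. Qed.

Lemma modN_lt a : a %% N < N.
Proof. by rewrite ltn_mod; apply: ltnW N_ge2. Qed.

Lemma k_leq : k.*2 <= n. Proof. rewrite /k; lia. Qed.

Lemma addr_lt i j : i < n -> j < n -> addr i j < K.
Proof. rewrite /addr /K; nia. Qed.

Lemma addr_inj i j i' j' : j < n -> j' < n ->
  (addr i' j' == addr i j) = (i' == i) && (j' == j).
Proof.
move=> jn jn'; rewrite /addr eqn_add2l; apply/eqP/andP => [E|[/eqP-> /eqP->]] //.
have Ei : i' = i.
  by have := congr1 (divn^~ n) E; rewrite ![n * _]mulnC !divnMDl ?divn_small ?addn0 //; lia.
by split; [apply/eqP | move: E; rewrite Ei => /addnI ->].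
Qed.

(** The register list is a function [f] of the accumulator and the counter, so that one lemma serves
    the loops computing [r], [r ^ k] and [2 ^ k]. *)
Lemma runs_power x y f m b c :
    (forall v w i, set_nth 0 (f v i) x w = f w i) ->
    (forall v i j, set_nth 0 (f v i) 10 j = f v j) ->
    (forall v i, nth 0 (f v i) x = v) -> (forall v i, nth 0 (f v i) 10 = i) ->
    (forall v i, eval (State (f v i) m) y = b) ->
    esize y <= 100 -> x < 12 -> 0 < b -> b ^ c < 2 ^ L ->
  run (c * 3 + 1) (Repeat 10 (x <~ $x * y)) (State (f 1 c) m)
    (fun s => s = State (f (b ^ c) 0) m).
Proof.
move=> fx f10 nx n10 ey sy x12 b0 bL.
apply: (runs_weaken (leqnn _) _ (@runs_repeat L K 12 300 L_pos 1 10 _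
  (fun i s => i <= c /\ s = State (f (b ^ (c - i)) i) m) c _ isT isT _ _ _)).
- by move=> s' [_ ->]; rewrite subn0.
- by move=> i s' [_ ->] /=; rewrite n10.
- move=> i s' ic [ic' ->]; rewrite /set_reg /= f10.
  have E : b ^ (c - i.+1) * b = b ^ (c - i) by rewrite -expnSr subnSK.
  apply: runs_set => //=; first exact: L_pos.
  + by lia.
  + by rewrite nx ey E; apply: leq_ltn_trans bL; rewrite leq_pexp2l // leq_subr.
  + by rewrite nx ey E /set_reg /= fx; split=> //; apply: ltnW.
- by rewrite subnn.
Qed.

Definition same_input m := forall i, i < 1 + n * n -> nth 0 m i = nth 0 m0 i.

Lemma runs_copy tot q X Y acc l b m : same_input m ->
  run (n * n * 3 + 1) (Repeat 10 copy_body)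
    (State [:: tot; n; k; r; q; N; X; Y; acc; l; n * n; b] m)
    (fun s => exists m', [/\ same_input m',
       forall a, a < n * n -> nth 0 m' (1 + n * n + a) = nth 0 m0 (1 + a) &
       s = State [:: tot; n; k; r; q; N; X; Y; acc; l; 0; b] m']).
Proof.
move=> sm.
apply: (runs_weaken (leqnn _) _ (@runs_repeat L K 12 300 L_pos 1 10 _
  (fun i s => exists m', [/\ same_input m',
     forall a, i <= a < n * n -> nth 0 m' (1 + n * n + a) = nth 0 m0 (1 + a) &
       s = State [:: tot; n; k; r; q; N; X; Y; acc; l; i; b] m'])
  (n * n) _ isT isT _ _ _)).
- by move=> s' [m' [h1 h2 ->]]; exists m'; split=> // a an; apply: h2.
- by move=> i s' [m' [_ _ ->]].
- move=> i s' ic [m' [h1 h2 ->]]; rewrite /set_reg /=.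
  apply: runs_good => -[_ _ _ gm].
  apply: runs_mem => //=; first exact: L_pos.
  + by rewrite /K; lia.
  exists (set_nth 0 m' (1 + n * n + i) (nth 0 m' (1 + i))); split=> //.
  + move=> a an; rewrite nth_set_nth /= ifF ?h1 //; apply/eqP; lia.
  + move=> a /andP[ia an]; rewrite nth_set_nth /= eqn_add2l.
    case: eqP => [->|ai]; first by rewrite h1 //; lia.
    by apply: h2; rewrite an andbT; lia.
- by exists m; split=> // a; lia.
Qed.

Variable R : comNzRingType.
Hypothesis N0 : (N%:R = 0 :> R)%R.

(** In a ring where [N] vanishes the reductions performed by the program disappear, and its numbers
    can be compared directly with [sieve]. *)
Lemma natr_modN a : ((a %% N)%:R = a%:R :> R)%R.
Proof. by rewrite [in RHS](divn_eq a N) natrD natrM N0 mulr0 add0r. Qed.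

(** Only the leading block is constrained: rows and columns of eliminated pairs are not read again
    for the same subset. *)
Definition represents m d (A : nat -> nat -> R) :=
  forall i j, i < d -> j < d -> ((nth 0 m (addr i j))%:R = A i j)%R.

Lemma runs_update tot q X Y acc l b m (A : nat -> nat -> R) :
    l < k -> same_input m -> represents m l.+1.*2 A ->
  run (2 * l * (2 * l) * 3 + 1) (Repeat 10 update_body)
    (State [:: tot; n; k; r; q; N; X; Y; acc; l; 2 * l * (2 * l); b] m)
    (fun s => exists m', [/\ same_input m',
       represents m' l.*2 (bump_mx (b%:R * r%:R)%R l A) &
       s = State [:: tot; n; k; r; q; N; X; Y; acc; l; 0; b] m']).
Proof.
move=> lk sm mA; have kn := k_leq.
(* The counter descends, so the entries of the block with position [t] or above have been
   replaced. *)
pose updated t i j := [&& i < 2 * l, j < 2 * l & t <= i * (2 * l) + j].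
apply: (runs_weaken (leqnn _) _ (@runs_repeat L K 12 300 L_pos 1 10 _
  (fun t s => exists m', [/\ same_input m',
     represents m' l.+1.*2 (fun i j =>
       if updated t i j then bump_mx (b%:R * r%:R)%R l A i j else A i j) &
     s = State [:: tot; n; k; r; q; N; X; Y; acc; l; t; b] m'])
  (2 * l * (2 * l)) _ isT isT _ _ _)).
- move=> s' [m' [h1 h2 ->]]; exists m'; split=> // i j il jl.
  rewrite h2 /updated ?leq0n ?andbT; try lia.
  by rewrite mul2n il jl.
- by move=> i s' [m' [_ _ ->]].
- move=> t s' tl [m' [h1 h2 ->]]; rewrite /set_reg /=.
  set i := t %/ (2 * l); set j := t %% (2 * l).
  have l0 : 0 < 2 * l by lia.
  have il : i < 2 * l by rewrite /i ltn_divLR.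
  have jl : j < 2 * l by rewrite /j ltn_mod.
  have tE : t = i * (2 * l) + j by rewrite /i /j -divn_eq.
  apply: runs_mem => //=; first exact: L_pos.
  + by rewrite -/i -/j; apply: addr_lt; lia.
  + exact: ltn_trans (modN_lt _) NL.
  rewrite -/i -/j /set_mem /=; eexists; split; last by [].
  + move=> a an; rewrite nth_set_nth /= ifF ?h1 //; apply/eqP; lia.
  move=> i' j' il' jl'; rewrite nth_set_nth /=.
  rewrite -/(addr i' j') -/(addr i j) addr_inj; try lia.
  (* Every entry read here is still old: the target has position [t], and the rows [2 l] and
     [2 l + 1] lie outside the block. *)
  have old i1 j1 : i1 < l.+1.*2 -> j1 < l.+1.*2 -> updated t.+1 i1 j1 = false ->
      ((nth 0 m' (addr i1 j1))%:R = A i1 j1)%R.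
    by move=> h3 h4 d; rewrite h2 // d.
  have [/andP[/eqP -> /eqP ->]|ne] := ifP.
    rewrite natr_modN /updated il jl -tE leqnn /=.
    rewrite !(natrD, natrM) /bump_mx /cross -!mul2n -[(2 * l).+1]addn1.
    by rewrite /addr in old; rewrite !old // /updated; lia.
  rewrite h2 //; congr (if _ then _ else _); rewrite /updated.
  case: (ltnP i' (2 * l)) => //= il''; case: (ltnP j' (2 * l)) => //= jl''.
  rewrite [in RHS]leq_eqVlt; case: eqP => //= E; case/negP: ne.
  have E' : i * (2 * l) + j = i' * (2 * l) + j' by rewrite -tE.
  have Ei : i = i'.
    by have := congr1 (divn^~ (2 * l)) E'; rewrite !divnMDl // !divn_small // !addn0.
  by rewrite Ei eqxx; move/eqP: E'; rewrite Ei eqn_add2l eq_sym.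
- exists m; split=> // i j il jl; rewrite mA // ifF // /updated; apply/negP; nia.
Qed.

Definition input_mx i j : R := ((nth 0 m0 (1 + (n * i + j)))%:R)%R.

Definition level_time := n * n * 3 + 5.

(** Invariant: the product so far times the [sieve_term] of the remaining levels is constant; at
    level 0 that term is 1. *)
Lemma runs_levels tot q X Y acc b m (A : nat -> nat -> R) :
    same_input m -> represents m k.*2 A -> acc < N ->
  run (k * level_time.+2 + 1) (Repeat 9 level_body)
    (State [:: tot; n; k; r; q; N; X; Y; acc; k; 0; b] m)
    (fun s => exists m' Y' acc' b', [/\ same_input m', acc' < N,
       (acc'%:R = acc%:R * sieve_term r%:R k Y A)%R &
       s = State [:: tot; n; k; r; q; N; X; Y'; acc'; 0; 0; b'] m']).
Proof.
move=> sm mA accN; have kn := k_leq.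
apply: (runs_weaken (leqnn _) _ (@runs_repeat L K 12 300 L_pos level_time 9 _
  (fun l s => exists m' Y' acc' b' A', [/\ same_input m', represents m' l.*2 A', acc' < N,
     (acc'%:R * sieve_term r%:R l Y' A' = acc%:R * sieve_term r%:R k Y A)%R &
     s = State [:: tot; n; k; r; q; N; X; Y'; acc'; l; 0; b'] m'])
  k _ isT isT _ _ _)).
- move=> s' [m' [Y' [acc' [b' [A' [h1 _ h2 h3 ->]]]]]].
  by exists m', Y', acc', b'; split=> //; rewrite -h3 /= mulr1.
- by move=> l s' [m' [Y' [acc' [b' [A' [_ _ _ _ ->]]]]]].
- move=> l s' lk [m' [Y' [acc' [b' [A' [h1 h2 h3 h4 ->]]]]]]; rewrite /set_reg /=.
  apply: runs_good => -[_ _ gr _].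
  have Y'L : Y' < 2 ^ L by apply: (gr 7).
  apply: (@runs_weaken _ _ _ _ (2 * l * (2 * l) * 3 + 1).+4); [|move=> s'' H; exact: H|].
    rewrite /level_time; nia.
  apply: runs_set_seq => //=; first exact: L_pos.
    by apply: small_lt; rewrite -ltnS ltnW // ltnS ltn_mod.
  apply: runs_set_seq => //=; first exact: L_pos.
    exact: leq_ltn_trans (leq_div _ _) Y'L.
  apply: runs_set_seq => //=; first exact: L_pos.
    exact: ltn_trans (modN_lt _) NL.
  apply: runs_set_seq => //=; first exact: L_pos.
    by apply: leq_ltn_trans KL; rewrite /K; nia.
  rewrite /set_reg /=.
  apply: (runs_weaken (leqnn _) _ (runs_update lk h1 h2)) => s'' [m'' [g1 g2 ->]].
  exists m'', (Y' %/ 2); do 2!eexists; exists (bump_mx ((Y' %% 2)%:R * r%:R)%R l A').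
  split; last (by []); try done; first exact: modN_lt.
  rewrite natr_modN -h4 [in RHS]/= mulrA natrM; congr (_ * _ * _)%R.
  rewrite !(natrD, natrM) -!mul2n -[in RHS](addn1 (2 * l)).
  have h5 := h2 (2 * l) (2 * l + 1).
  rewrite /addr in h5; rewrite h5; [|lia|lia].
  have N1 : ((N - 1)%:R = -1 :> R)%R.
    by rewrite natrB ?N0 ?sub0r // ltnW // N_ge2.
  by rewrite N1 natrB // -ltnS ltn_mod.
- by exists m, Y, acc, b, A.
Qed.

Definition subset_time := n * n * 3 + k * level_time.+2 + 7.

(** The counter is itself the code of the subset. It descends from [2 ^ k], and the total covers all
    codes from the current one upwards. *)
Lemma runs_subsets q :
  run (2 ^ k * subset_time.+2 + 1) (Repeat 6 subset_body)
    (State [:: 0; n; k; r; q; N; 2 ^ k; 0; 0; 0; 0; 0] m0)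
    (fun s => exists m' tot rest, [/\ tot < N,
       (tot%:R = sieve r%:R k input_mx)%R &
       s = State (tot :: n :: k :: r :: q :: rest) m']).
Proof.
have kn := k_leq; set A := input_mx.
apply: (runs_weaken (leqnn _) _ (@runs_repeat L K 12 300 L_pos subset_time 6 _
  (fun X s => exists m' tot Y acc l b, [/\ same_input m', X <= 2 ^ k, tot < N,
     (tot%:R = \sum_(X <= Z < 2 ^ k) sieve_term r%:R k Z A)%R &
     s = State [:: tot; n; k; r; q; N; X; Y; acc; l; 0; b] m'])
  (2 ^ k) _ isT isT _ _ _)).
- move=> s' [m' [tot [Y [acc [l [b [h1 _ h2 h3 ->]]]]]]].
  by exists m', tot; eexists; split; last (by []); try done; rewrite h3 sum_sieve_term.
- by move=> X s' [m' [tot [Y [acc [l [b [_ _ _ _ ->]]]]]]].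
- move=> X s' Xk [m' [tot [Y [acc [l [b [h1 _ h2 h3 ->]]]]]]]; rewrite /set_reg /=.
  apply: runs_good => -[_ _ gr _].
  have XL : X < 2 ^ L by apply: (gr 6).
  have -> : subset_time = ((n * n * 3 + 1) + ((k * level_time.+2 + 1) + 1).+1).+3.
    by rewrite /subset_time; lia.
  apply: runs_set_seq => //=; first exact: L_pos.
  apply: runs_set_seq => //=; [exact: L_pos | exact: small_lt |].
  apply: runs_set_seq => //=; first exact: L_pos.
    by apply: leq_ltn_trans KL; rewrite /K; lia.
  rewrite /set_reg /=; apply: runs_seq.
  apply: (runs_weaken (leqnn _) _ (runs_copy h1)) => s1 [m1 [g1 g2 ->]].
  apply: runs_set_seq => //=; first exact: L_pos.
    by apply: leq_ltn_trans KL; rewrite /K; nia.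
  rewrite /set_reg /=; apply: runs_seq.
  have mA : represents m1 k.*2 A.
    by move=> i j ik jk; rewrite /addr g2 //; nia.
  apply: (runs_weaken (leqnn _) _ (runs_levels g1 mA N_ge2)).
  move=> s2 [m2 [Y2 [acc2 [b2 [f1 f2 f3 ->]]]]].
  apply: runs_set => //=; first exact: L_pos.
    exact: ltn_trans (modN_lt _) NL.
  rewrite /set_reg /=; do 6!eexists; split; last (by []); try done; first exact: ltnW.
    exact: modN_lt.
  by rewrite natr_modN natrD h3 f3 mul1r [in RHS]big_ltn // addrC.
- exists m0, 0, 0, 0, 0, 0; split=> //; first by apply: ltnW N_ge2.
  by rewrite big_geq.
Qed.

Definition program_time :=
  (3 * (n * n) + 6 * k + 2 ^ k * subset_time.+2) + 20.

Lemma runs_program :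
  run program_time program (State [::] m0)
    (fun s => exists tot, [/\ tot < N,
       (tot%:R = sieve r%:R k input_mx)%R &
       output s = (1 - n %% 2) * (tot %/ r ^ k)]).
Proof.
have kn := k_leq.
apply: (@runs_weaken _ _ _ _
  (((n * n + 1) * 3 + 1) + ((k * 3 + 1) +
    ((k * 3 + 1) + ((2 ^ k * subset_time.+2 + 1) + 1)).+3).+2).+4.+1);
  [by rewrite /program_time; lia | move=> s' H; exact: H |].
have k2 : 2 ^ k < 2 ^ L.
  apply: leq_ltn_trans NL; apply: leq_trans (_ : r ^ k <= _).
    by case: (k) => [|k'] //; rewrite leq_exp2r ?r_ge2.
  by rewrite leq_pmulr // (ltnW r_ge2).
have rkL : r ^ k < 2 ^ L.
  by apply: leq_ltn_trans NL; rewrite leq_pmulr // (ltnW r_ge2).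
apply: runs_set_seq => //=; [exact: L_pos | exact: small_lt |].
apply: runs_set_seq => //=; first exact: L_pos.
  by rewrite m0n; apply: leq_ltn_trans KL; rewrite /K; nia.
rewrite m0n; apply: runs_set_seq => //=; first exact: L_pos.
  by apply: leq_ltn_trans KL; rewrite /K; nia.
apply: runs_set_seq => //=; [exact: L_pos | exact: small_lt |].
apply: runs_set_seq => //=; first exact: L_pos.
  by apply: leq_ltn_trans KL; rewrite /K; lia.
rewrite /set_reg /= -/k; apply: runs_seq.
apply: (runs_weaken (leqnn _) _ (@runs_power 3 _
  (fun v i => [:: 0; n; k; v; 0; 0; 0; 0; 0; 0; i; 0]) m0 2 (n * n + 1)
  _ _ _ _ _ _ _ _ r_lt)) => // s1 ->.
apply: runs_set_seq => //=; [exact: L_pos | exact: small_lt |].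
apply: runs_set_seq => //=; first exact: L_pos.
  by apply: leq_ltn_trans KL; rewrite /K; nia.
rewrite /set_reg /= -/r; apply: runs_seq.
apply: (runs_weaken (leqnn _) _ (@runs_power 4 _
  (fun v i => [:: 0; n; k; r; v; 0; 0; 0; 0; 0; i; 0]) m0 r k
  _ _ _ _ _ _ _ (ltnW r_ge2) rkL)) => // s2 ->.
apply: runs_set_seq => //=; first exact: L_pos.
apply: runs_set_seq => //=; [exact: L_pos | exact: small_lt |].
apply: runs_set_seq => //=; first exact: L_pos.
  by apply: leq_ltn_trans KL; rewrite /K; nia.
rewrite /set_reg /= -/N; apply: runs_seq.
apply: (runs_weaken (leqnn _) _ (@runs_power 6 _
  (fun v i => [:: 0; n; k; r; r ^ k; N; v; 0; 0; 0; i; 0]) m0 2 k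
  _ _ _ _ _ _ _ _ k2)) => // s3 ->.
apply: runs_seq; apply: (runs_weaken (leqnn _) _ (@runs_subsets _)).
move=> s4 [m4 [tot [rest [h1 h2 ->]]]].
apply: runs_set => //=; first exact: L_pos.
  apply: leq_ltn_trans (_ : tot < _); last exact: ltn_trans NL.
  apply: leq_trans (leq_div tot (r ^ k)); rewrite -[X in _ <= X]mul1n leq_mul2r.
  by rewrite leq_subr orbT.
by exists tot.
Qed.

End Program.

(** * Correctness on encoded graphs *)

Lemma nth_allpairs (S T U : Type) (f : S -> T -> U) s t x0 y0 z0 i j :
  i < size s -> j < size t ->
  nth z0 [seq f x y | x <- s, y <- t] (size t * i + j) = f (nth x0 s i) (nth y0 t j).
Proof.
move=> + jt; elim: s i => [|x s IH] [|i] //= si; rewrite nth_cat size_map.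
  by rewrite muln0 jt (nth_map y0).
by rewrite ifF ?mulnS -?addnA ?addKn ?IH //; apply/negP; lia.
Qed.

Section Input.

Variables (V : finType) (G : graph V).
Let n := #|V|.
Let k := n %/ 2.
Let r := 2 ^ (n * n + 1).
Let N := r ^ k * r.

Lemma size_encode : size (encode G) = 1 + n * n.
Proof. by rewrite /= size_allpairs -!cardE add1n. Qed.

Lemma nth_encode x0 i j : i < n -> j < n ->
  nth 0 (encode G) (1 + (n * i + j)) =
  nat_of_bool ([set nth x0 (enum V) i; nth x0 (enum V) j] \in edges G).
Proof. by rewrite add1n /= /n cardE => iV jV; rewrite (nth_allpairs _ x0 x0). Qed.

Lemma encode_le1 a : nth 0 (encode G) a.+1 <= 1.
Proof.
rewrite /=; set s := [seq _ | _ <- _, _ <- _].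
have [|/(mem_nth 0)] := leqP (size s) a; first by move/(nth_default 0) ->.
by case/allpairsP => -[u v] [_ _ ->]; case: (_ \in _).
Qed.

Lemma haf_encode (R : comNzRingType) : n = k.*2 ->
  ((num_perfect_matchings G)%:R = haf (input_mx n (encode G) R) k (vertices k))%R.
Proof.
move=> nk; have -> : num_perfect_matchings G = #|matchings_of G [set: V]| by [].
(* A vertex is needed as the default of [nth], so the empty graph is treated apart. *)
case: (pickP V) => [x0 _|V0]; last first.
  have n0 : n = 0 by apply: eq_card0 => x; have := V0 x.
  have -> : k = 0 by rewrite /k n0.
  have -> : [set: V] = [set x in [::]] by apply/setP => x; have := V0 x.
  by rewrite (@haf_matchings _ _ _ 0 [::]).
have gI : {in vertices k &, injective (nth x0 (enum V))}.
  move=> i j; rewrite !mem_vertices -nk /n cardE => ik jk /eqP.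
  by rewrite nth_uniq ?enum_uniq // => /eqP.
pose A u v : R := ([set u; v] \in edges G)%:R%R.
rewrite -(@haf_map _ _ _ (nth x0 (enum V)) A) //; last first.
  by move=> i j; rewrite !mem_vertices -nk => ik jk; rewrite /input_mx (nth_encode x0).
have sz : size [seq nth x0 (enum V) i | i <- vertices k] = n.
  by rewrite size_map nk; elim: (k) => //= k' ->.
have us : uniq [seq nth x0 (enum V) i | i <- vertices k].
  by rewrite map_inj_in_uniq ?vertices_uniq.
rewrite -haf_matchings ?sz //; congr (#|pred_of_set (matchings_of G _)|%:R)%R.
apply/setP => x; rewrite !inE; symmetry.
(* A duplicate-free list of [#|V|] vertices contains them all. *)
have /subset_leqif_card : [seq nth x0 (enum V) i | i <- vertices k] \subset V.
  by apply/subsetP.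
rewrite (card_uniqP us) sz => -[_]; rewrite eqxx => /esym/subsetP; exact.
Qed.

(** Modulo [N = r ^ k.+1] the error term of [sieve_haf] vanishes, so [tot] is congruent to [r ^ k]
    times the count. Both are below [N], as the count is below [r], hence equal. For odd [n] both
    sides are 0. *)
Lemma decode_total tot : tot < N ->
  (tot%:R = sieve r%:R k (input_mx n (encode G) 'Z_N))%R ->
  (1 - n %% 2) * (tot %/ r ^ k) = num_perfect_matchings G.
Proof.
move=> totN totE; rewrite modn2.
have E : num_perfect_matchings G = #|matchings_of G [set: V]| by [].
case: (boolP (odd n)) => [on|en].
  by rewrite E matchings_odd ?cards0 ?cardsT.
have nk : n = k.*2 by rewrite /k divn2 even_halfK.
have N2 : 1 < N := N_ge2 n.
have r0 : 0 < r ^ k := rk_gt0 n.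
have [h] := sieve_haf k r%:R%R (input_mx n (encode G) 'Z_N).
rewrite -totE -haf_encode // -!natrX expnSr -/N pchar_Zp // mul0r addr0 -natrM.
move/(congr1 (@nat_of_ord _)); rewrite !val_Zp_nat // !modn_small //; last first.
  rewrite ltn_pmul2l // E /r; apply: leq_trans (card_matchings_lt _ _) _.
  by rewrite addn1.
by move=> ->; rewrite mulKn // mul1n.
Qed.

Lemma input_size_ge : 1 + n * n <= input_size G.
Proof.
by rewrite -size_encode /input_size /cells_size -sum1_size; apply: leq_sum.
Qed.

(** The modulus is 2 to the power [(n * n + 1) * k.+1], and one more digit accommodates it. *)
Definition word_length := (n * n + 1) * k.+1 + 1.

Lemma modulus_lt : N < 2 ^ word_length.
Proof. by rewrite /N /r /word_length -expnM -expnD ltn_exp2l // mulnS; lia. Qed.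

Lemma cells_lt : 1 + n * n + n * n < 2 ^ word_length.
Proof.
apply: ltn_trans modulus_lt; apply: leq_trans (_ : r <= _).
  rewrite /r addn1 expnS; have := ltn_expl (n * n) (ltnSn 1); lia.
by rewrite leq_pmull // !expn_gt0.
Qed.

Lemma good_initial : good word_length (1 + n * n + n * n) 12 (initial_state G).
Proof.
split=> //.
- by rewrite size_encode; lia.
- by move=> i; rewrite nth_nil expn_gt0.
- case=> [|i]; first by apply: leq_ltn_trans cells_lt; rewrite /= -/n; nia.
  by apply: leq_ltn_trans (encode_le1 i) _;
    rewrite -[X in X < _](expn0 2) ltn_exp2l // /word_length addn1.
Qed.

End Input.

(* For odd n the exponent n./2 is rounded down; the factor sqrt 2 is absorbed
   by the polynomial p. *)
Theorem theorem5p1 :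
  exists (c : cmd) (p q : {poly nat}),
  forall (V : finType) (G : graph V) (n : nat), #|V| = n ->
  exists (s : state) (t m : nat),
  [/\ exec c (initial_state G) s t m,
      output s = num_perfect_matchings G,
      t <= p.[input_size G]%R * 2 ^ n./2 &
      m <= q.[input_size G]%R].
Proof.
(* At the input size these bound, in turn, [word_length], [step_cost] for expressions of size 300,
   and [program_time] divided by [2 ^ k]. *)
pose wordP : {poly nat} := ('X * ('X + 1) + 1)%R.
pose costP : {poly nat} := (600%:P * (300%:P * wordP + 1) + 2%:P)%R.
pose timeP : {poly nat} := (12%:P * 'X + 'X * (3%:P * 'X + 7%:P) + 29%:P)%R.
exists program, (timeP * costP)%R, ((12%:P + 2%:P * 'X) * (wordP + 1) + costP)%R.
move=> V G n <-{n}; set z := input_size G; set n := #|V|.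
have zn : 1 + n * n <= z := input_size_ge G.
have [] := @runs_program n (encode G) (word_length V) erefl (modulus_lt V) (cells_lt V)
   'Z_((2 ^ (n * n + 1)) ^ (n %/ 2) * 2 ^ (n * n + 1)) _ (good_initial G).
  by rewrite pchar_Zp ?N_ge2.
move=> s [t [m [ex tT mM _ [tot [totN totE out]]]]]; exists s, t, m.
have kn : n %/ 2 <= n by rewrite leq_div.
have wordE : wordP.[z]%R = z * (z + 1) + 1.
  by rewrite /wordP !(hornerD, hornerM, hornerX, hornerC).
have word_le : word_length V <= wordP.[z]%R.
  by rewrite wordE /word_length leq_add2r leq_mul //; nia.
have costE : costP.[z]%R = 600 * (300 * wordP.[z]%R + 1) + 2.
  by rewrite /costP !(hornerD, hornerM, hornerX, hornerC).
have cost_le : step_cost (word_length V) 300 <= costP.[z]%R.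
  by rewrite costE /step_cost; lia.
have timeE : timeP.[z]%R = 12 * z + z * (3 * z + 7) + 29.
  by rewrite /timeP !(hornerD, hornerM, hornerX, hornerC).
split=> //; first by rewrite out (decode_total totN totE).
  apply: leq_trans tT _; rewrite hornerM -[(_ * _)%R]/(_ * _) mulnAC -divn2.
  apply: leq_mul => //; rewrite timeE /program_time /subset_time /level_time -/n.
  have kz : n %/ 2 * (n * n * 3 + 5).+2 <= z * (3 * z + 7) by apply: leq_mul; nia.
  rewrite [X in _ <= X]mulnC.
  set P := 2 ^ (n %/ 2); have P0 : 0 < P by rewrite expn_gt0.
  (* The time spent outside the loop over subsets is also multiplied by [P >= 1], so that [P]
     factors out. *)
  apply: (@leq_trans (P * (3 * (n * n) + 6 * (n %/ 2) + 20) +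
      P * (n * n * 3 + n %/ 2 * (n * n * 3 + 5).+2 + 7).+2)).
    by rewrite addnAC leq_add2r leq_pmull.
  by rewrite -mulnDr leq_mul2l; apply/orP; right; nia.
(* Twelve registers, the input cells and the working matrix. *)
have cells_le : 12 + (1 + n * n + n * n) <= 12 + 2 * z by lia.
have word_le' : (word_length V).+1 <= wordP.[z]%R + 1 by rewrite addn1 ltnS.
have spaceE : ((12%:P + 2%:P * 'X) * (wordP + 1) + costP).[z]%R =
    (12 + 2 * z) * (wordP.[z]%R + 1) + costP.[z]%R.
  by rewrite /costP /wordP !(hornerD, hornerM, hornerX, hornerC).
by rewrite spaceE; apply: leq_trans mM _; apply: leq_add => //; apply: leq_mul.
Qed.
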